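(* Let $\mathbf{f}=(f_1,f_2):\mathbb{R}^2\to\mathbb{R}^2$ be a continuously differentiable vector field, and consider the control system on $\mathbb{R}^3$ with state $(x_1,x_2,x_3)$ and inputs $u_1,u_2$, $$\dot{x}_1=u_1,\quad \dot{x}_2=u_2,\quad \dot{x}_3=f_1(x_1,x_2)u_1+f_2(x_1,x_2)u_2.$$ The following are equivalent: (1) The system is controllable. (2) There exists a closed loop $\gamma$ in $\mathbb{R}^2$ such that the line integral $\oint_{\gamma}\mathbf{f}\cdot d\mathbf{x}\neq 0$. (3) The curl $\nabla\times\mathbf{f}$ is not identically zero on $\mathbb{R}^2$.
   Context: The system is controllable if for every pair of states $p,q$ in the state space there exist a finite time $T>0$ and piecewise continuous real-valued inputs on $[0,T]$ whose corresponding trajectory starts at $p$ at time $0$ and is at $q$ at time $T$. A closed loop is a piecewise continuously differentiable closed curve. For a vector field $\mathbf{f}=(f_1,f_2)$ on $\mathbb{R}^2$, the curl $\nabla\times\mathbf{f}$ is $\frac{\partial f_2}{\partial x_1}-\frac{\partial f_1}{\partial x_2}$ (regarded as the component along the unit vector normal to the plane). *)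

(* Defs.v *)
From Stdlib Require Import Reals.
From Coquelicot Require Import Coquelicot.
Open Scope R_scope.

Definition segment (a b t : R) : Prop := a <= t <= b.

Definition partition (a b : R) (n : nat) (t : nat -> R) : Prop :=
  t 0%nat = a /\ t n = b /\ (forall i, (i < n)%nat -> t i < t (S i)).

Definition continuous_piece (u : R -> R) (c d : R) : Prop :=
  (forall t, c < t < d -> continuous u t) /\
  (exists l : R, filterlim u (at_right c) (locally l)) /\
  (exists l : R, filterlim u (at_left d) (locally l)).

(* Functions on [a, b] are total functions of which only the values on [a, b]
   matter; the values at the breakpoints are unconstrained. *)
Definition piecewise_continuous (u : R -> R) (a b : R) : Prop :=
  exists (n : nat) (t : nat -> R), partition a b n t /\
    forall i, (i < n)%nat -> continuous_piece u (t i) (t (S i)).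

(* Continuity on [a, b] together with the one-sided limits of the derivative
   makes g continuously differentiable on each closed piece, with one-sided
   derivatives at its end points. *)
Definition piecewise_C1 (g : R -> R) (a b : R) : Prop :=
  continuous_on (segment a b) g /\
  exists (n : nat) (t : nat -> R), partition a b n t /\
    forall i, (i < n)%nat ->
      (forall s, t i < s < t (S i) -> ex_derive g s) /\
      continuous_piece (Derive g) (t i) (t (S i)).

Definition partial1 (h : R * R -> R) (p : R * R) : R :=
  Derive (fun x => h (x, snd p)) (fst p).

Definition partial2 (h : R * R -> R) (p : R * R) : R :=
  Derive (fun y => h (fst p, y)) (snd p).

Definition C1_function (h : R * R -> R) : Prop :=
  forall p : R * R,
    ex_derive (fun x => h (x, snd p)) (fst p) /\
    ex_derive (fun y => h (fst p, y)) (snd p) /\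
    continuous (partial1 h) p /\
    continuous (partial2 h) p.

Definition comp1 (f : R * R -> R * R) (p : R * R) : R := fst (f p).

Definition comp2 (f : R * R -> R * R) (p : R * R) : R := snd (f p).

Definition C1_field (f : R * R -> R * R) : Prop :=
  C1_function (comp1 f) /\ C1_function (comp2 f).

Definition curl (f : R * R -> R * R) (p : R * R) : R :=
  partial1 (comp2 f) p - partial2 (comp1 f) p.

(* Simplicity and regularity (non-vanishing velocity) are not required. *)
Definition closed_loop (g : R -> R * R) (a b : R) : Prop :=
  a < b /\
  piecewise_C1 (fun t => fst (g t)) a b /\
  piecewise_C1 (fun t => snd (g t)) a b /\
  g a = g b.

(* For a piecewise C1 curve the integrand is defined except at finitely many
   points, where the value of Derive does not affect the integral. *)
Definition line_integral (f : R * R -> R * R) (g : R -> R * R) (a b : R) : R :=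
  RInt (fun t => comp1 f (g t) * Derive (fun s => fst (g s)) t +
                 comp2 f (g t) * Derive (fun s => snd (g s)) t) a b.

(* For piecewise continuous inputs a solution is continuous and satisfies the
   differential equations wherever the inputs are continuous. *)
Definition trajectory (f : R * R -> R * R) (T : R) (u1 u2 x1 x2 x3 : R -> R)
    : Prop :=
  continuous_on (segment 0 T) x1 /\
  continuous_on (segment 0 T) x2 /\
  continuous_on (segment 0 T) x3 /\
  forall t, 0 < t < T -> continuous u1 t -> continuous u2 t ->
    is_derive x1 t (u1 t) /\
    is_derive x2 t (u2 t) /\
    is_derive x3 t (comp1 f (x1 t, x2 t) * u1 t + comp2 f (x1 t, x2 t) * u2 t).

Definition controllable (f : R * R -> R * R) : Prop :=
  forall p q : R * R * R,
    exists (T : R) (u1 u2 x1 x2 x3 : R -> R),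
      0 < T /\
      piecewise_continuous u1 0 T /\
      piecewise_continuous u2 0 T /\
      trajectory f T u1 u2 x1 x2 x3 /\
      (x1 0, x2 0, x3 0) = p /\
      (x1 T, x2 T, x3 T) = q.

(* Main.v *)
Require Import Defs.
From Stdlib Require Import Reals Lra Lia Classical.
From Coquelicot Require Import Coquelicot.
Open Scope R_scope.

(** The third equation says that [x3] integrates the form [f1 dx1 + f2 dx2]
    along the planar path [(x1, x2)], which the inputs prescribe freely.  The
    three conditions are linked in a cycle.

    Controllable implies a loop: a trajectory from [(0, 0, 0)] to [(0, 0, 1)]
    projects to a closed planar curve, and [x3] is a primitive of the integrand
    along it, so the line integral is [1] ([controllable_loop]).

    A loop implies curl: if the curl vanishes, so does the circulation around
    every rectangle, because its derivative in the height of the rectangle is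
    the integral of the curl along the moving side ([green_derivative]).
    Integrating [f] along the two sides of a rectangle with a corner at the
    origin then gives the same value in either order, hence a potential of [f],
    and the integral over a closed loop is a difference of equal values of the
    potential ([curl_free_closed_loop]).

    Curl implies controllable: by the same derivative formula, a nonzero curl
    forces a nonzero circulation around some rectangle
    ([circulation_free_curl]).  Driving round that rectangle changes [x3] and
    nothing else.  By continuity a lower rectangle realizes every smaller
    change, the reversed loop realizes the opposite one, and repetition
    realizes all of them ([polygonal_vertical]).  So any two states are joined
    by going in the plane to the corner of the rectangle, adjusting [x3] there,
    and going on to the target.  Such a polygonal route is followed with
    piecewise constant inputs ([polygonal_motion]).

    Both implications that start from piecewise data rest on one fundamental
    theorem of calculus for curves that are smooth between finitely many
    breakpoints ([line_integral_primitive]). *)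


(** * Subdivisions of an interval *)

(** An inductive form of partitions, on which common refinements and
    concatenations are inductions on the list of pieces instead of manipulations
    of indices. *)
Inductive subdivision (P : R -> R -> Prop) : R -> R -> Prop :=
| sub_nil a : subdivision P a a
| sub_cons a b c :
    a < b -> P a b -> subdivision P b c -> subdivision P a c.

Lemma subdivision_le P a b : subdivision P a b -> a <= b.
Proof. induction 1; lra. Qed.

Lemma subdivision_one (P : R -> R -> Prop) a b :
  a < b -> P a b -> subdivision P a b.
Proof. intros; eapply sub_cons; eauto; constructor. Qed.

Lemma subdivision_app P a b c :
  subdivision P a b -> subdivision P b c -> subdivision P a c.
Proof. induction 1; intros; auto. eapply sub_cons; eauto. Qed.

Lemma subdivision_impl (P Q : R -> R -> Prop) a b :
  (forall c d, a <= c -> c < d -> d <= b -> P c d -> Q c d) ->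
  subdivision P a b -> subdivision Q a b.
Proof.
  intros H S; revert H; induction S as [a|a b c Hab Pab S IH]; intros H.
  - constructor.
  - pose proof (subdivision_le _ _ _ S).
    apply sub_cons with b; auto.
    + apply H; auto; lra.
    + apply IH; intros; apply H; auto; lra.
Qed.

Lemma subdivision_of_partition (P : R -> R -> Prop) a b n t :
  partition a b n t -> (forall i, (i < n)%nat -> P (t i) (t (S i))) ->
  subdivision P a b.
Proof.
  revert b; induction n as [|n IH]; intros b [H0 [Hn Hlt]] HP.
  - rewrite <- H0, <- Hn; constructor.
  - apply subdivision_app with (t n).
    + apply IH; [repeat split; auto|]; intros; auto.
    + rewrite <- Hn; apply subdivision_one; auto.
Qed.

Lemma partition_of_subdivision (P : R -> R -> Prop) a b :
  subdivision P a b ->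
  exists n t, partition a b n t /\
    forall i, (i < n)%nat -> P (t i) (t (S i)).
Proof.
  induction 1 as [a|a b c Hab Pab Sbc (n & t & (H0 & Hn & Hlt) & HP)].
  - exists 0%nat, (fun _ => a); repeat split; intros; lia.
  - exists (S n), (fun i => match i with O => a | S j => t j end).
    repeat split; auto; intros [|i] Hi; try rewrite H0; auto with arith.
Qed.

Definition hereditary (P : R -> R -> Prop) : Prop :=
  forall a b c d, a <= c -> c < d -> d <= b -> P a b -> P c d.

Lemma subdivision_split P a b c :
  hereditary P -> a <= b <= c -> subdivision P a c ->
  subdivision P a b /\ subdivision P b c.
Proof.
  intros HP Hb S; revert Hb; induction S as [a|a d c Had Pad S IH]; intros Hb.
  - replace b with a by lra; split; constructor.
  - destruct (Rlt_le_dec b d) as [Hbd|Hdb].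
    + split.
      * destruct (Rle_lt_or_eq_dec a b) as [Hab| ->]; try lra.
        -- apply subdivision_one; auto. apply (HP a d); auto; lra.
        -- constructor.
      * apply sub_cons with d; auto. apply (HP a d); auto; lra.
    + destruct IH as [IH1 IH2]; [lra|]. split; auto.
      apply sub_cons with d; auto.
Qed.

(** Each piece of the first subdivision cuts the second one, and heredity
    preserves both properties on the cut pieces. *)
Lemma subdivision_refine P Q a b :
  hereditary P -> hereditary Q ->
  subdivision P a b -> subdivision Q a b ->
  subdivision (fun c d => P c d /\ Q c d) a b.
Proof.
  intros HP HQ S; induction S as [a|a b c Hab Pab S IH]; intros T.
  - constructor.
  - pose proof (subdivision_le _ _ _ S).
    destruct (subdivision_split Q a b c) as [T1 T2]; auto; [lra|].
    apply subdivision_app with b; auto.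
    revert T1; apply subdivision_impl; intros u v Hu Huv Hv Quv.
    split; auto. apply (HP a b); auto.
Qed.

Lemma at_right_le_locally x : filter_le (at_right x) (locally x).
Proof. intros P [e He]; exists e; auto. Qed.

Lemma at_left_le_locally x : filter_le (at_left x) (locally x).
Proof. intros P [e He]; exists e; auto. Qed.

Lemma continuous_piece_hereditary u : hereditary (continuous_piece u).
Proof.
  intros a b c d Hac Hcd Hdb (Hc & [l Hl] & [r Hr]); split; [|split].
  - intros; apply Hc; lra.
  - destruct (Rle_lt_or_eq_dec a c) as [H| <-]; auto; [|exists l; auto].
    exists (u c). eapply filterlim_filter_le_1; [apply at_right_le_locally|].
    apply Hc; lra.
  - destruct (Rle_lt_or_eq_dec d b) as [H| ->]; auto; [|exists r; auto].
    exists (u d). eapply filterlim_filter_le_1; [apply at_left_le_locally|].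
    apply Hc; lra.
Qed.

Lemma locally_interval a b t : a < t < b -> locally t (fun s => a < s < b).
Proof.
  intros H. assert (He : 0 < Rmin (t - a) (b - t)) by (apply Rmin_pos; lra).
  exists (mkposreal _ He); intros s Hs.
  apply Rabs_lt_between in Hs; simpl in Hs.
  pose proof (Rmin_l (t - a) (b - t)); pose proof (Rmin_r (t - a) (b - t)).
  unfold minus, plus, opp in Hs; simpl in Hs; lra.
Qed.

Lemma at_right_interval c d : c < d -> at_right c (fun s => c < s < d).
Proof.
  intros H. assert (He : 0 < d - c) by lra.
  exists (mkposreal _ He); intros s Hs Hcs.
  apply Rabs_lt_between in Hs; simpl in Hs.
  unfold minus, plus, opp in Hs; simpl in Hs; lra.
Qed.

Lemma at_left_interval c d : c < d -> at_left d (fun s => c < s < d).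
Proof.
  intros H. assert (He : 0 < d - c) by lra.
  exists (mkposreal _ He); intros s Hs Hcs.
  apply Rabs_lt_between in Hs; simpl in Hs.
  unfold minus, plus, opp in Hs; simpl in Hs; lra.
Qed.

Lemma continuous_piece_ext u v c d :
  c < d -> (forall t, c < t < d -> u t = v t) ->
  continuous_piece u c d -> continuous_piece v c d.
Proof.
  intros Hcd E (Hc & [l Hl] & [r Hr]); split; [|split].
  - intros t Ht. apply continuous_ext_loc with u; auto.
    apply filter_imp with (2 := locally_interval c d t Ht); auto.
  - exists l. apply filterlim_ext_loc with u; auto.
    apply filter_imp with (2 := at_right_interval c d Hcd); auto.
  - exists r. apply filterlim_ext_loc with u; auto.
    apply filter_imp with (2 := at_left_interval c d Hcd); auto.
Qed.

(** The one-sided limits serve as boundary values, so that on one piece the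
    integrand can be replaced by a function continuous on the whole line. *)
Lemma continuous_piece_extend (u : R -> R) c d :
  c < d -> continuous_piece u c d ->
  exists v : R -> R, (forall t, continuous v t) /\ forall t, c < t < d -> v t = u t.
Proof.
  intros Hcd (Hc & [l Hl] & [r Hr]).
  destruct (C0_extension_lt u l r c d) as (v & Hv & E & _); auto.
  exists v; auto.
Qed.

Lemma continuous_on_extend (F : R -> R) c d :
  c < d -> continuous_on (segment c d) F ->
  exists G : R -> R, (forall t, continuous G t) /\ forall t, c <= t <= d -> G t = F t.
Proof.
  intros Hcd HF.
  destruct (C0_extension_lt F (F c) (F d) c d) as (G & HG & E & Ec & Ed); auto.
  - intros t Ht. apply continuous_continuous_on with (segment c d); auto.
    apply filter_imp with (2 := locally_interval c d t Ht); unfold segment; intros; lra.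
  - intros P HP. assert (Hs : segment c d c) by (unfold segment; lra).
    pose proof (HF c Hs P HP) as HW.
    change (at_right c (fun x => P (F x))).
    unfold filtermap, within in HW.
    generalize (filter_and _ _ (at_right_le_locally _ _ HW)
                  (at_right_interval c d Hcd)).
    apply filter_imp; unfold segment; intros x [H1 H2]; apply H1; lra.
  - intros P HP. assert (Hs : segment c d d) by (unfold segment; lra).
    pose proof (HF d Hs P HP) as HW.
    change (at_left d (fun x => P (F x))).
    unfold filtermap, within in HW.
    generalize (filter_and _ _ (at_left_le_locally _ _ HW)
                  (at_left_interval c d Hcd)).
    apply filter_imp; unfold segment; intros x [H1 H2]; apply H1; lra.
  - exists G; split; auto. intros t Ht.
    destruct (Rle_lt_or_eq_dec c t) as [H1| <-]; try lra; auto.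
    destruct (Rle_lt_or_eq_dec t d) as [H2| ->]; try lra; auto.
Qed.

(** The derivative of [F] is known only inside the interval, so the standard
    theorem does not apply at the end points.  Instead, [F] minus the integral of
    [J] is continuous up to the end points with zero derivative inside, hence
    constant by the mean value theorem. *)
Lemma FTC_piece (F J : R -> R) c d :
  c < d -> (forall t, continuous J t) -> continuous_on (segment c d) F ->
  (forall t, c < t < d -> is_derive F t (J t)) ->
  is_RInt J c d (F d - F c).
Proof.
  intros Hcd HJ HF HD.
  destruct (continuous_on_extend F c d Hcd HF) as (G & HG & E).
  assert (HI : forall t, is_derive (fun y => RInt J c y) t (J t)).
  { intros t. apply is_derive_RInt with c; auto.
    apply filter_forall; intros y; apply RInt_correct.
    apply (ex_RInt_continuous J); auto. }
  destruct (MVT_gen (fun t => G t - RInt J c t) c d (fun _ => 0))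
    as (m & _ & Hm).
  - rewrite Rmin_left, Rmax_right by lra; intros t Ht.
    replace 0 with (J t - J t) by lra.
    apply (is_derive_minus G (fun t => RInt J c t)); auto.
    apply is_derive_ext_loc with F; auto.
    apply filter_imp with (2 := locally_interval c d t Ht).
    intros; symmetry; apply E; lra.
  - intros t _. apply continuity_pt_filterlim.
    apply (continuous_minus G (fun t => RInt J c t)); auto.
    apply ex_derive_continuous; eexists; apply HI.
  - cbv beta in Hm. rewrite RInt_point in Hm. unfold zero in Hm; simpl in Hm.
    replace (F d - F c) with (RInt J c d).
    + apply (RInt_correct (V := R_CompleteNormedModule)), (ex_RInt_continuous J); auto.
    + rewrite <- (E d), <- (E c) by lra. lra.
Qed.


(** * Line integrals along piecewise smooth curves *)

(** Continuity of the partial derivatives gives total differentiability; the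
    joint continuity of [f] and the chain rule along curves follow from it. *)
Lemma C1_function_filterdiff h p :
  C1_function h ->
  filterdiff h (locally p)
    (fun v => plus (scal (fst v) (partial1 h p)) (scal (snd v) (partial2 h p))).
Proof.
  intros Hh. destruct p as [x y].
  apply filterdiff_ext with (fun u => h (fst u, snd u)).
  { intros [u v]; reflexivity. }
  apply (is_derive_filterdiff (fun u v => h (u, v)) x y
           (fun u v => partial1 h (u, v))).
  - apply filter_forall; intros u; apply Derive_correct.
    apply (proj1 (Hh u)).
  - apply Derive_correct. apply (proj1 (proj2 (Hh (x, y)))).
  - apply continuous_ext with (partial1 h); [intros [u v]; reflexivity|].
    destruct (Hh (x, y)) as (_ & _ & H & _); exact H.
Qed.

Lemma C1_function_continuous h p : C1_function h -> continuous h p.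
Proof.
  intros Hh.
  apply (filterdiff_continuous (K := R_AbsRing) (V := R_NormedModule)
    (U := prod_NormedModule _ R_NormedModule R_NormedModule) h p).
  eexists; apply C1_function_filterdiff; auto.
Qed.

Lemma C1_function_partials_continuous h p :
  C1_function h -> continuous (partial1 h) p /\ continuous (partial2 h) p.
Proof. intros Hh; destruct (Hh p) as (_ & _ & H); exact H. Qed.

Definition C1_piece (g : R -> R) (c d : R) : Prop :=
  (forall s, c < s < d -> ex_derive g s) /\ continuous_piece (Derive g) c d.

Lemma C1_piece_hereditary g : hereditary (C1_piece g).
Proof.
  intros a b c d H1 H2 H3 [HD HC]; split.
  - intros; apply HD; lra.
  - apply (continuous_piece_hereditary _ a b); auto.
Qed.

Definition integrand (f : R * R -> R * R) (x1 x2 : R -> R) (t : R) : R :=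
  comp1 f (x1 t, x2 t) * Derive x1 t + comp2 f (x1 t, x2 t) * Derive x2 t.

Lemma continuous_along (h : R * R -> R) (x1 x2 : R -> R) t :
  continuous h (x1 t, x2 t) -> continuous x1 t -> continuous x2 t ->
  continuous (fun s => h (x1 s, x2 s)) t.
Proof.
  intros Hh H1 H2. apply (continuous_comp_2 x1 x2 (fun u v => h (u, v))); auto.
  apply continuous_ext with h; auto. intros [u v]; reflexivity.
Qed.

Lemma continuous_power (h1 h2 : R * R -> R) (x1 x2 v1 v2 : R -> R) t :
  (forall p, continuous h1 p) -> (forall p, continuous h2 p) ->
  continuous x1 t -> continuous x2 t -> continuous v1 t -> continuous v2 t ->
  continuous (fun s => h1 (x1 s, x2 s) * v1 s + h2 (x1 s, x2 s) * v2 s) t.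
Proof.
  intros. apply (continuous_plus (fun s => h1 (x1 s, x2 s) * v1 s)).
  - apply (continuous_mult (fun s => h1 (x1 s, x2 s)) v1); auto.
    apply continuous_along; auto.
  - apply (continuous_mult (fun s => h2 (x1 s, x2 s)) v2); auto.
    apply continuous_along; auto.
Qed.

(** On each piece the velocities are replaced by continuous extensions, which
    changes the integrand at most at the end points; the increments of [F] over
    the pieces then add up because [F] is continuous at the breakpoints. *)
Lemma line_integral_primitive f x1 x2 F a b :
  C1_field f ->
  subdivision (fun c d => (C1_piece x1 c d /\ C1_piece x2 c d) /\
     forall t, c < t < d -> is_derive F t (integrand f x1 x2 t)) a b ->
  continuous_on (segment a b) x1 -> continuous_on (segment a b) x2 ->
  continuous_on (segment a b) F ->
  is_RInt (integrand f x1 x2) a b (F b - F a).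
Proof.
  intros [Hf1 Hf2] S; induction S as [a|a b c Hab [[[D1 C1] [D2 C2]] HF] S IH];
    intros H1 H2 H3.
  - replace (F a - F a) with 0 by lra. apply (is_RInt_point (integrand f x1 x2)).
  - pose proof (subdivision_le _ _ _ S) as Hbc.
    assert (L : forall t, segment a b t -> segment a c t)
      by (unfold segment; intros; lra).
    assert (T : forall t, segment b c t -> segment a c t)
      by (unfold segment; intros; lra).
    replace (F c - F a) with (plus (F b - F a) (F c - F b))
      by (unfold plus; simpl; lra).
    apply (is_RInt_Chasles (V := R_NormedModule) _ a b c).
    + destruct (continuous_on_extend x1 a b Hab) as (X1 & HX1 & EX1);
        [now apply continuous_on_subset with (2 := H1)|].
      destruct (continuous_on_extend x2 a b Hab) as (X2 & HX2 & EX2);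
        [now apply continuous_on_subset with (2 := H2)|].
      destruct (continuous_piece_extend _ a b Hab C1) as (V1 & HV1 & EV1).
      destruct (continuous_piece_extend _ a b Hab C2) as (V2 & HV2 & EV2).
      set (J := fun t => comp1 f (X1 t, X2 t) * V1 t + comp2 f (X1 t, X2 t) * V2 t).
      assert (EJ : forall t, a < t < b -> J t = integrand f x1 x2 t).
      { intros t Ht; unfold J, integrand.
        rewrite EX1, EX2, EV1, EV2 by lra; reflexivity. }
      apply is_RInt_ext with J.
      { rewrite Rmin_left, Rmax_right by lra; auto. }
      apply FTC_piece; auto.
      * intros t; apply continuous_power; auto;
          intros; apply C1_function_continuous; auto.
      * now apply continuous_on_subset with (2 := H3).
      * intros t Ht; rewrite EJ by lra; auto.
    + apply IH; eapply continuous_on_subset; eauto.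
Qed.

Lemma piecewise_C1_subdivision g a b :
  piecewise_C1 g a b -> subdivision (C1_piece g) a b.
Proof.
  intros [_ (n & t & Hp & H)].
  apply (subdivision_of_partition (C1_piece g) a b n t Hp H).
Qed.

Lemma piecewise_C1_pair_subdivision x1 x2 a b :
  piecewise_C1 x1 a b -> piecewise_C1 x2 a b ->
  subdivision (fun c d => C1_piece x1 c d /\ C1_piece x2 c d) a b.
Proof.
  intros H1 H2; apply subdivision_refine;
    auto using C1_piece_hereditary, piecewise_C1_subdivision.
Qed.

Lemma continuous_on_along (h : R * R -> R) (x1 x2 : R -> R) D :
  (forall p, continuous h p) ->
  continuous_on D x1 -> continuous_on D x2 ->
  continuous_on D (fun t => h (x1 t, x2 t)).
Proof.
  intros Hh H1 H2 t Ht.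
  apply (filterlim_comp_2 (G := locally (x1 t)) (H := locally (x2 t))
           (F := within D (locally t)) x1 x2 (fun u v => h (u, v))); auto.
  intros P HP. destruct (Hh _ P HP) as [e He].
  exists (ball (x1 t) e) (ball (x2 t) e); try apply locally_ball.
  intros u v Hu Hv; apply He; split; auto.
Qed.

Lemma is_derive_along (h : R * R -> R) (x1 x2 : R -> R) t :
  C1_function h -> ex_derive x1 t -> ex_derive x2 t ->
  is_derive (fun s => h (x1 s, x2 s)) t
    (partial1 h (x1 t, x2 t) * Derive x1 t + partial2 h (x1 t, x2 t) * Derive x2 t).
Proof.
  intros Hh H1 H2.
  pose proof (C1_function_filterdiff h (x1 t, x2 t) Hh) as HD.
  unfold is_derive.
  eapply filterdiff_ext_lin.
  - apply (filterdiff_comp'_2 x1 x2 (fun u v => h (u, v)) t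
       (fun s => scal s (Derive x1 t)) (fun s => scal s (Derive x2 t))
       (fun u v => plus (scal u (partial1 h (x1 t, x2 t)))
                     (scal v (partial2 h (x1 t, x2 t))))).
    + apply (Derive_correct _ _ H1).
    + apply (Derive_correct _ _ H2).
    + apply filterdiff_ext with (2 := HD). intros [u v]; reflexivity.
  - intros y; cbn. unfold scal, plus, mult; simpl; unfold mult; simpl. ring.
Qed.

Lemma gradient_closed_loop f phi g a b :
  C1_field f -> C1_function phi ->
  (forall p, partial1 phi p = comp1 f p) ->
  (forall p, partial2 phi p = comp2 f p) ->
  closed_loop g a b -> line_integral f g a b = 0.
Proof.
  intros Hf Hphi E1 E2 (Hab & H1 & H2 & Hg).
  set (x1 := fun t => fst (g t)); set (x2 := fun t => snd (g t)).
  unfold line_integral.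
  replace 0 with (phi (x1 b, x2 b) - phi (x1 a, x2 a)).
  - rewrite (RInt_ext _ (integrand f x1 x2)).
    2:{ intros t _; unfold integrand, x1, x2; rewrite <- surjective_pairing.
        reflexivity. }
    apply is_RInt_unique.
    apply (line_integral_primitive f x1 x2 (fun t => phi (x1 t, x2 t))); auto.
    + generalize (piecewise_C1_pair_subdivision _ _ _ _ H1 H2).
      apply subdivision_impl; intros c d _ Hcd _ HP; split; auto.
      intros t Ht; unfold integrand; rewrite <- E1, <- E2.
      apply is_derive_along; auto; apply HP; auto.
    + apply H1.
    + apply H2.
    + apply continuous_on_along; [|apply H1|apply H2].
      intros; apply C1_function_continuous; auto.
  - unfold x1, x2; rewrite Hg; lra.
Qed.

(** * Circulation around rectangles, and potentials *)


(** The line integral around the boundary of the rectangle with opposite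
    corners [(a, b)] and [(x, y)], starting along the side at height [b]. *)
Definition circulation (f : R * R -> R * R) (a x b y : R) : R :=
  RInt (fun s => comp1 f (s, b)) a x + RInt (fun t => comp2 f (x, t)) b y -
  RInt (fun s => comp1 f (s, y)) a x - RInt (fun t => comp2 f (a, t)) b y.

Lemma continuous_slice1 (h : R * R -> R) y s :
  (forall p, continuous h p) -> continuous (fun s => h (s, y)) s.
Proof.
  intros Hh. apply (continuous_along h (fun s => s) (fun _ => y)); auto.
  apply continuous_id. apply continuous_const.
Qed.

Lemma continuous_slice2 (h : R * R -> R) x t :
  (forall p, continuous h p) -> continuous (fun t => h (x, t)) t.
Proof.
  intros Hh. apply (continuous_along h (fun _ => x) (fun t => t)); auto.
  apply continuous_const. apply continuous_id.
Qed.

Lemma is_derive_RInt_continuous (h : R -> R) a x :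
  (forall s, continuous h s) -> is_derive (fun x => RInt h a x) x (h x).
Proof.
  intros Hh. apply (is_derive_RInt h (fun x => RInt h a x) a); auto.
  apply filter_forall; intros y.
  apply (RInt_correct (V := R_CompleteNormedModule)), (ex_RInt_continuous h); auto.
Qed.

Lemma curl_continuous f p : C1_field f -> continuous (curl f) p.
Proof.
  intros [H1 H2]. apply (continuous_minus (partial1 (comp2 f))).
  - apply (proj1 (C1_function_partials_continuous _ p H2)).
  - apply (proj2 (C1_function_partials_continuous _ p H1)).
Qed.

(** Green's theorem for rectangles, differentiated in the height: the vertical
    sides contribute [f2 (x, y) - f2 (a, y)], which is the integral of the
    first partial derivative of [f2] along the side at height [y], and
    differentiating under the integral over that side gives minus the integral
    of the second partial derivative of [f1]. *)
Lemma green_derivative f a x b y :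
  C1_field f ->
  is_derive (fun y => circulation f a x b y) y
    (RInt (fun s => curl f (s, y)) a x).
Proof.
  intros Hf; pose proof Hf as [H1 H2].
  assert (C1 : forall p, continuous (comp1 f) p)
    by (intros; apply C1_function_continuous; auto).
  assert (C2 : forall p, continuous (comp2 f) p)
    by (intros; apply C1_function_continuous; auto).
  assert (P1 : forall p, continuous (partial1 (comp2 f)) p)
    by (intros p; apply (proj1 (C1_function_partials_continuous _ p H2))).
  assert (P2 : forall p, continuous (partial2 (comp1 f)) p)
    by (intros p; apply (proj2 (C1_function_partials_continuous _ p H1))).
  (* Difference of the two vertical sides, as an integral over the moving one. *)
  assert (D2 : RInt (fun s => partial1 (comp2 f) (s, y)) a x =
               comp2 f (x, y) - comp2 f (a, y)).
  { apply is_RInt_unique.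
    apply (is_RInt_derive (fun s => comp2 f (s, y))).
    - intros s _. apply Derive_correct, (H2 (s, y)).
    - intros s _. apply (continuous_slice1 (partial1 (comp2 f))); auto. }
  replace (RInt (fun s => curl f (s, y)) a x) with
    (0 + comp2 f (x, y) - RInt (fun s => partial2 (comp1 f) (s, y)) a x
       - comp2 f (a, y)).
  2:{ unfold curl.
      rewrite (RInt_minus (fun s => partial1 (comp2 f) (s, y))
                (fun s => partial2 (comp1 f) (s, y))).
      - rewrite D2. unfold minus, plus, opp; simpl; ring.
      - apply (ex_RInt_continuous (fun s => partial1 (comp2 f) (s, y))).
        intros; apply continuous_slice1; auto.
      - apply (ex_RInt_continuous (fun s => partial2 (comp1 f) (s, y))).
        intros; apply continuous_slice1; auto. }
  unfold circulation.
  apply (is_derive_minus (fun y => RInt (fun s => comp1 f (s, b)) a x +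
     RInt (fun t => comp2 f (x, t)) b y - RInt (fun s => comp1 f (s, y)) a x)).
  2:{ apply (is_derive_RInt_continuous (fun t => comp2 f (a, t))).
      intros; apply continuous_slice2; auto. }
  apply (is_derive_minus (fun y => RInt (fun s => comp1 f (s, b)) a x +
     RInt (fun t => comp2 f (x, t)) b y)).
  - apply (is_derive_plus (fun _ => RInt (fun s => comp1 f (s, b)) a x)).
    + apply (is_derive_const (RInt (fun s => comp1 f (s, b)) a x)).
    + apply (is_derive_RInt_continuous (fun t => comp2 f (x, t))).
      intros; apply continuous_slice2; auto.
  - apply (is_derive_RInt_param (fun u t => comp1 f (t, u))).
    + apply filter_forall; intros u t _. apply (H1 (t, u)).
    + intros t _. apply continuity_2d_pt_filterlim.
      change (continuous (fun z => partial2 (comp1 f) (snd z, fst z)) (y, t)).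
      apply (continuous_comp_2 snd fst (fun u v => partial2 (comp1 f) (u, v))).
      * apply continuous_snd.
      * apply continuous_fst.
      * apply continuous_ext with (partial2 (comp1 f)); auto.
    + apply filter_forall; intros u.
      apply (ex_RInt_continuous (fun t => comp1 f (t, u))).
      intros; apply continuous_slice1; auto.
Qed.

Lemma circulation_degenerate f a x b : circulation f a x b b = 0.
Proof. unfold circulation; rewrite !RInt_point; unfold zero; simpl; ring. Qed.

Lemma curl_free_circulation f a x b y :
  C1_field f -> (forall p, curl f p = 0) -> circulation f a x b y = 0.
Proof.
  intros Hf Hc. rewrite <- (circulation_degenerate f a x b).
  destruct (MVT_gen (fun y => circulation f a x b y) b y
     (fun y => RInt (fun s => curl f (s, y)) a x)) as (m & _ & Hm).
  - intros; apply green_derivative; auto.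
  - intros; apply continuity_pt_filterlim.
    apply (ex_derive_continuous (fun y => circulation f a x b y)).
    eexists; apply green_derivative; auto.
  - cbv beta in Hm. rewrite (RInt_ext _ (fun _ => 0)), RInt_const in Hm by auto.
    unfold scal in Hm; simpl in Hm; unfold mult in Hm; simpl in Hm. lra.
Qed.

(** Vanishing circulation makes the integral of the curl vanish on every
    horizontal segment that starts on the axis [x = 0]; differentiating in the
    free end point gives the curl itself. *)
Lemma circulation_free_curl f :
  C1_field f -> (forall a x b y, circulation f a x b y = 0) ->
  forall p, curl f p = 0.
Proof.
  intros Hf H0 [x y].
  assert (E : forall x, RInt (fun s => curl f (s, y)) 0 x = 0).
  { intros z. transitivity (Derive (fun y => circulation f 0 z 0 y) y).
    { symmetry; apply is_derive_unique, green_derivative; auto. }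
    rewrite (Derive_ext _ (fun _ => 0)) by auto. apply Derive_const. }
  assert (Hx : is_derive (fun x => RInt (fun s => curl f (s, y)) 0 x) x
                 (curl f (x, y))).
  { apply (is_derive_RInt_continuous (fun s => curl f (s, y))).
    intros; apply continuous_slice1; intros; apply curl_continuous; auto. }
  rewrite <- (is_derive_unique _ _ _ Hx).
  rewrite (Derive_ext _ (fun _ => 0)) by auto. apply Derive_const.
Qed.

(** The integral of [f] from the origin along a horizontal and then a vertical
    segment. *)
Definition potential (f : R * R -> R * R) (p : R * R) : R :=
  RInt (fun s => comp1 f (s, 0)) 0 (fst p) +
  RInt (fun t => comp2 f (fst p, t)) 0 (snd p).

(** The vertical segment comes last in [potential], so the derivative in [y] is
    immediate.  For the derivative in [x], vanishing circulation allows the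
    two segments to be taken in the other order. *)
Lemma potential_gradient f (p : R * R) :
  C1_field f -> (forall p, curl f p = 0) ->
  is_derive (fun x => potential f (x, snd p)) (fst p) (comp1 f p) /\
  is_derive (fun y => potential f (fst p, y)) (snd p) (comp2 f p).
Proof.
  intros Hf Hc. destruct p as [x y]; unfold potential; simpl.
  assert (C1 : forall p, continuous (comp1 f) p)
    by (intros; apply C1_function_continuous, Hf).
  assert (C2 : forall p, continuous (comp2 f) p)
    by (intros; apply C1_function_continuous, Hf).
  split.
  - apply is_derive_ext with
      (fun x => RInt (fun s => comp1 f (s, y)) 0 x +
                RInt (fun t => comp2 f (0, t)) 0 y).
    { intros u. pose proof (curl_free_circulation f 0 u 0 y Hf Hc) as H.
      unfold circulation in H. lra. }
    rewrite <- (Rplus_0_r (comp1 f (x, y))).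
    apply (is_derive_plus (fun x => RInt (fun s => comp1 f (s, y)) 0 x)).
    + apply (is_derive_RInt_continuous (fun s => comp1 f (s, y))).
      intros; apply continuous_slice1; auto.
    + apply (is_derive_const (RInt (fun t => comp2 f (0, t)) 0 y)).
  - rewrite <- (Rplus_0_l (comp2 f (x, y))).
    apply (is_derive_plus (fun _ => RInt (fun s => comp1 f (s, 0)) 0 x)).
    + apply (is_derive_const (RInt (fun s => comp1 f (s, 0)) 0 x)).
    + apply (is_derive_RInt_continuous (fun t => comp2 f (x, t))).
      intros; apply continuous_slice2; auto.
Qed.

Lemma curl_free_closed_loop f g a b :
  C1_field f -> (forall p, curl f p = 0) -> closed_loop g a b ->
  line_integral f g a b = 0.
Proof.
  intros Hf Hc Hg.
  assert (E1 : forall p, partial1 (potential f) p = comp1 f p)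
    by (intros p; apply is_derive_unique, potential_gradient; auto).
  assert (E2 : forall p, partial2 (potential f) p = comp2 f p)
    by (intros p; apply is_derive_unique, potential_gradient; auto).
  apply (gradient_closed_loop f (potential f)); auto.
  intros p; repeat split.
  - eexists; apply potential_gradient; auto.
  - eexists; apply potential_gradient; auto.
  - apply continuous_ext with (comp1 f); [auto|].
    apply C1_function_continuous, Hf.
  - apply continuous_ext with (comp2 f); [auto|].
    apply C1_function_continuous, Hf.
Qed.


(** * Polygonal motions *)

(** The change of [x3] up to time [s] when the plane point moves from [(x, y)]
    with constant velocity [(a, c)]. *)
Definition lift (f : R * R -> R * R) (x y a c s : R) : R :=
  RInt (fun s => comp1 f (x + a * s, y + c * s) * a +
                 comp2 f (x + a * s, y + c * s) * c) 0 s.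

Lemma lift_continuous f x y a c s :
  C1_field f ->
  continuous (fun s => comp1 f (x + a * s, y + c * s) * a +
                       comp2 f (x + a * s, y + c * s) * c) s.
Proof.
  intros [H1 H2].
  apply (continuous_power (comp1 f) (comp2 f) (fun s => x + a * s)
     (fun s => y + c * s) (fun _ => a) (fun _ => c));
    try (intros; apply C1_function_continuous; auto);
    try apply continuous_const;
    apply (ex_derive_continuous (fun s => _ + _ * s)); auto_derive; auto.
Qed.

Lemma lift_derive f x y a c s :
  C1_field f ->
  is_derive (lift f x y a c) s
    (comp1 f (x + a * s, y + c * s) * a + comp2 f (x + a * s, y + c * s) * c).
Proof.
  intros Hf. apply (is_derive_RInt_continuous (fun s =>
    comp1 f (x + a * s, y + c * s) * a + comp2 f (x + a * s, y + c * s) * c)).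
  intros; apply lift_continuous; auto.
Qed.

Lemma RInt_affine (h : R -> R) u v a b :
  (forall s, continuous h s) ->
  RInt (fun s => u * h (u * s + v)) a b = RInt h (u * a + v) (u * b + v).
Proof.
  intros Hh; apply (RInt_comp_lin h).
  apply (ex_RInt_continuous h); auto.
Qed.

Lemma RInt_extensional (g h : R -> R) a b :
  (forall s, g s = h s) -> RInt g a b = RInt h a b.
Proof. intros E; apply RInt_ext; auto. Qed.

Lemma lift_reverse f x y a c :
  C1_field f -> lift f (x + a) (y + c) (- a) (- c) 1 = - lift f x y a c 1.
Proof.
  intros Hf. unfold lift.
  set (h := fun s => comp1 f (x + a * s, y + c * s) * a +
                     comp2 f (x + a * s, y + c * s) * c).
  assert (Hh : forall s, continuous h s) by (intros; apply lift_continuous; auto).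
  rewrite (RInt_extensional _ (fun s => -1 * h (-1 * s + 1))).
  - rewrite RInt_affine by auto.
    replace (-1 * 0 + 1) with 1 by lra. replace (-1 * 1 + 1) with 0 by lra.
    rewrite <- opp_RInt_swap by (apply (ex_RInt_continuous h); auto).
    reflexivity.
  - intros s. unfold h.
    replace (x + a * (-1 * s + 1)) with (x + a + - a * s) by ring.
    replace (y + c * (-1 * s + 1)) with (y + c + - c * s) by ring.
    ring.
Qed.

Lemma lift_horizontal f x y a :
  C1_field f -> lift f x y a 0 1 = RInt (fun s => comp1 f (s, y)) x (x + a).
Proof.
  intros Hf. unfold lift.
  transitivity (RInt (fun s => comp1 f (s, y)) (a * 0 + x) (a * 1 + x));
    [|f_equal; ring].
  rewrite <- (RInt_affine (fun s => comp1 f (s, y))).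
  - apply RInt_extensional; intros s.
    replace (y + 0 * s) with y by ring.
    replace (x + a * s) with (a * s + x) by ring. ring.
  - intros; apply continuous_slice1; intros; apply C1_function_continuous, Hf.
Qed.

Lemma lift_vertical f x y c :
  C1_field f -> lift f x y 0 c 1 = RInt (fun t => comp2 f (x, t)) y (y + c).
Proof.
  intros Hf. unfold lift.
  transitivity (RInt (fun t => comp2 f (x, t)) (c * 0 + y) (c * 1 + y));
    [|f_equal; ring].
  rewrite <- (RInt_affine (fun t => comp2 f (x, t))).
  - apply RInt_extensional; intros s.
    replace (x + 0 * s) with x by ring.
    replace (y + c * s) with (c * s + y) by ring. ring.
  - intros; apply continuous_slice2; intros; apply C1_function_continuous, Hf.
Qed.

Definition move (f : R * R -> R * R) (p : R * R * R) (a c : R) : R * R * R :=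
  let '(x, y, z) := p in (x + a, y + c, z + lift f x y a c 1).

(** States joined by finitely many straight planar segments, each run through
    in unit time with [x3] following the third equation. *)
Inductive polygonal (f : R * R -> R * R) (p : R * R * R) : R * R * R -> Prop :=
| poly_refl : polygonal f p p
| poly_move q a c : polygonal f p q -> polygonal f p (move f q a c).

Lemma polygonal_trans f p q r :
  polygonal f p q -> polygonal f q r -> polygonal f p r.
Proof. intros H1 H2; induction H2; auto using poly_move. Qed.

Lemma polygonal_sym f p q : C1_field f -> polygonal f p q -> polygonal f q p.
Proof.
  intros Hf; induction 1 as [|q a c _ IH]; [constructor|].
  apply polygonal_trans with q; auto.
  replace q with (move f (move f q a c) (- a) (- c)) at 2.
  - apply poly_move, poly_refl.
  - destruct q as [[x y] z]; unfold move. rewrite lift_reverse by auto.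
    repeat f_equal; ring.
Qed.

(** The four sides are two segments and their reversals, so the lifts of the
    last two enter with a minus sign. *)
Lemma polygonal_rectangle f a x b y z :
  C1_field f -> polygonal f (a, b, z) (a, b, z + circulation f a x b y).
Proof.
  intros Hf.
  replace (a, b, z + circulation f a x b y) with
    (move f (move f (move f (move f (a, b, z) (x - a) 0) 0 (y - b))
       (- (x - a)) (- 0)) (- 0) (- (y - b))).
  - do 4 apply poly_move; apply poly_refl.
  - unfold move.
    replace (a + (x - a) + 0 + - (x - a) + -0) with a by ring.
    replace (b + 0 + (y - b) + -0 + - (y - b)) with b by ring.
    replace (a + (x - a) + 0 + - (x - a)) with (a + 0) by ring.
    replace (b + 0 + (y - b) + -0) with (b + (y - b)) by ring.
    rewrite (lift_reverse f a b 0 (y - b)) by auto.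
    replace (a + (x - a) + 0) with (a + (x - a)) by ring.
    replace (b + 0 + (y - b)) with (y + 0) by ring.
    rewrite (lift_reverse f a y (x - a) 0) by auto.
    rewrite !lift_horizontal, !lift_vertical by auto.
    unfold circulation.
    replace (a + (x - a)) with x by ring.
    replace (b + 0) with b by ring.
    replace (b + (y - b)) with y by ring.
    f_equal; ring.
Qed.

(** The circulation is continuous in the height of the rectangle and vanishes
    for height zero, so it takes all values between [0] and its value [C] for the
    given rectangle.  The loop run backwards gives the opposite values, hence
    every [e] with [Rabs e <= Rabs C]; a large change [d] is obtained by
    repeating [n] times the loop for [d / n]. *)
Lemma polygonal_vertical f a x b y z d :
  C1_field f -> circulation f a x b y <> 0 ->
  polygonal f (a, b, z) (a, b, z + d).
Proof.
  intros Hf HC. set (C := circulation f a x b y) in *.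
  assert (small : forall e z, Rmin 0 C <= e <= Rmax 0 C ->
            polygonal f (a, b, z) (a, b, z + e)).
  { intros e w He.
    destruct (IVT_gen (fun y => circulation f a x b y) b y e) as (k & _ & Hk).
    - intros t. apply continuity_pt_filterlim.
      apply (ex_derive_continuous (fun y => circulation f a x b y)).
      eexists; apply green_derivative; auto.
    - rewrite circulation_degenerate; exact He.
    - rewrite <- Hk; apply polygonal_rectangle; auto. }
  assert (small' : forall e z, Rabs e <= Rabs C -> polygonal f (a, b, z) (a, b, z + e)).
  { intros e w He.
    destruct (classic (Rmin 0 C <= e <= Rmax 0 C)) as [H|H]; auto.
    apply polygonal_sym; auto.
    replace w with (w + e + - e) at 2 by ring.
    apply small; revert He H; unfold Rabs, Rmin, Rmax.
    destruct (Rcase_abs e), (Rcase_abs C), (Rle_dec 0 C); intros; lra. }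
  assert (rep : forall e n z, Rabs e <= Rabs C ->
            polygonal f (a, b, z) (a, b, z + INR n * e)).
  { intros e n w He; induction n as [|n IH].
    - simpl; replace (w + 0 * e) with w by ring. apply poly_refl.
    - apply polygonal_trans with (1 := IH).
      replace (w + INR (S n) * e) with (w + INR n * e + e)
        by (rewrite S_INR; ring).
      auto. }
  assert (HC' : 0 < Rabs C) by (apply Rabs_pos_lt; auto).
  destruct (INR_unbounded (Rabs d / Rabs C)) as [n Hn].
  assert (Hn0 : 0 < INR n).
  { apply Rle_lt_trans with (2 := Hn).
    apply Rdiv_le_0_compat; auto; apply Rabs_pos. }
  replace d with (INR n * (d / INR n)) by (field; lra).
  apply rep. rewrite Rabs_div, (Rabs_pos_eq (INR n)) by lra.
  apply Rle_div_l; auto. apply Rlt_le.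
  apply Rlt_div_l in Hn; auto. lra.
Qed.

Lemma polygonal_full f a x b y p q :
  C1_field f -> circulation f a x b y <> 0 ->
  exists r c d, polygonal f p r /\ move f r c d = q.
Proof.
  intros Hf HC. destruct p as [[p1 p2] p3], q as [[q1 q2] q3].
  (* The last segment runs from the corner to the target; its start has the
     third coordinate that this segment carries to [q3]. *)
  exists (a, b, q3 - lift f a b (q1 - a) (q2 - b) 1), (q1 - a), (q2 - b).
  split.
  - apply polygonal_trans with (move f (p1, p2, p3) (a - p1) (b - p2)).
    + apply poly_move, poly_refl.
    + unfold move. set (w := p3 + _).
      replace (p1 + (a - p1)) with a by ring.
      replace (p2 + (b - p2)) with b by ring.
      match goal with |- polygonal f (_, w) (_, ?u) =>
        replace u with (w + (u - w)) by ring end.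
      apply polygonal_vertical with x y; auto.
  - unfold move; repeat f_equal; ring.
Qed.

(** * Trajectories *)

(** Trajectories whose state functions are continuous on the whole line, not
    only on [[0, T]], so that they can be composed with [Rmin] when they are
    prolonged.  The duration may be [0], which gives the induction a start. *)
Definition motion (f : R * R -> R * R) (T : R) (p q : R * R * R) : Prop :=
  exists u1 u2 x1 x2 x3 : R -> R,
    subdivision (continuous_piece u1) 0 T /\
    subdivision (continuous_piece u2) 0 T /\
    (forall t, continuous x1 t) /\ (forall t, continuous x2 t) /\
    (forall t, continuous x3 t) /\
    (forall t, 0 < t < T -> continuous u1 t -> continuous u2 t ->
      is_derive x1 t (u1 t) /\ is_derive x2 t (u2 t) /\
      is_derive x3 t (comp1 f (x1 t, x2 t) * u1 t + comp2 f (x1 t, x2 t) * u2 t)) /\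
    (x1 0, x2 0, x3 0) = p /\ (x1 T, x2 T, x3 T) = q.

(** The value at the switching time differs from the limit [a] on the right, so
    the input is never continuous there, and the differential equation is
    imposed only on either side of [T]. *)
Definition switch (u : R -> R) (T a t : R) : R :=
  if Rlt_dec t T then u t else if Rlt_dec T t then a else a + 1.

Lemma switch_before u T a t : t < T -> switch u T a t = u t.
Proof. intros; unfold switch; destruct (Rlt_dec t T); lra. Qed.

Lemma switch_after u T a t : T < t -> switch u T a t = a.
Proof.
  intros; unfold switch; destruct (Rlt_dec t T), (Rlt_dec T t); lra.
Qed.

Lemma switch_not_continuous u T a : ~ continuous (switch u T a) T.
Proof.
  intros H.
  assert (L : filterlim (switch u T a) (at_right T) (locally a)).
  { apply filterlim_ext_loc with (fun _ => a); [|apply filterlim_const].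
    apply filter_imp with (2 := at_right_interval T (T + 1) ltac:(lra)).
    intros t Ht; rewrite switch_after by lra; auto. }
  assert (L' : filterlim (switch u T a) (at_right T) (locally (switch u T a T)))
    by (apply (filterlim_filter_le_1 _ (at_right_le_locally T)); exact H).
  pose proof (filterlim_locally_unique _ _ _ L L') as E.
  unfold switch in E; destruct (Rlt_dec T T); lra.
Qed.

Lemma switch_subdivision u T a :
  subdivision (continuous_piece u) 0 T ->
  subdivision (continuous_piece (switch u T a)) 0 (T + 1).
Proof.
  intros S. apply subdivision_app with T.
  - revert S; apply subdivision_impl; intros c d _ Hcd HdT.
    apply continuous_piece_ext; auto.
    intros; rewrite switch_before by lra; auto.
  - apply subdivision_one; [lra|].
    apply continuous_piece_ext with (fun _ => a); [lra| |].
    + intros; rewrite switch_after by lra; auto.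
    + repeat split.
      * intros; apply continuous_const.
      * exists a; apply filterlim_const.
      * exists a; apply filterlim_const.
Qed.

(** Gluing by clamping the time: for [w 0 = 0] it is [x] before [T] and
    [x T + w (t - T)] after [T], and its continuity follows from that of [x] and
    [w] without looking at the two sides of [T] separately. *)
Definition prolong (x : R -> R) (T : R) (w : R -> R) (t : R) : R :=
  x (Rmin t T) + w (Rmax (t - T) 0).

Lemma prolong_before x T w t : w 0 = 0 -> t <= T -> prolong x T w t = x t.
Proof.
  intros H Ht; unfold prolong. rewrite Rmin_left, Rmax_right by lra. lra.
Qed.

Lemma prolong_after x T w t : T <= t -> prolong x T w t = x T + w (t - T).
Proof. intros Ht; unfold prolong. rewrite Rmin_right, Rmax_left by lra. lra. Qed.

Lemma prolong_continuous x T w t :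
  (forall s, continuous x s) -> (forall s, continuous w s) ->
  continuous (prolong x T w) t.
Proof.
  intros Hx Hw.
  assert (HA : continuous (fun s => Rabs (s - T)) t).
  { apply (continuous_comp (fun s => s - T) Rabs); [|apply continuous_Rabs].
    apply (ex_derive_continuous (fun s => s - T)); auto_derive; auto. }
  apply (continuous_plus (fun t => x (Rmin t T))).
  - apply (continuous_comp (fun t => Rmin t T) x); auto.
    (* [Rmin s T] and [Rmax (s - T) 0] are expressed by the absolute value. *)
    apply (continuous_ext (fun s => s - (s - T + Rabs (s - T)) / 2)).
    + intros s; unfold Rmin, Rabs; destruct (Rle_dec s T), (Rcase_abs (s - T)); lra.
    + apply (continuous_minus (fun s : R => s)); [apply continuous_id|].
      apply (continuous_mult (fun s => s - T + Rabs (s - T))); [|apply continuous_const].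
      apply (continuous_plus (fun s => s - T)); auto.
      apply (ex_derive_continuous (fun s => s - T)); auto_derive; auto.
  - apply (continuous_comp (fun t => Rmax (t - T) 0) w); auto.
    apply (continuous_ext (fun s => (s - T + Rabs (s - T)) / 2)).
    + intros s; unfold Rmax, Rabs; destruct (Rle_dec (s - T) 0), (Rcase_abs (s - T)); lra.
    + apply (continuous_mult (fun s => s - T + Rabs (s - T))); [|apply continuous_const].
      apply (continuous_plus (fun s => s - T)); auto.
      apply (ex_derive_continuous (fun s => s - T)); auto_derive; auto.
Qed.

Lemma prolong_derive_before x T w t l :
  w 0 = 0 -> t < T -> is_derive x t l -> is_derive (prolong x T w) t l.
Proof.
  intros Hw Ht. apply is_derive_ext_loc.
  apply filter_imp with (2 := locally_interval (t - 1) T t ltac:(lra)).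
  intros; rewrite prolong_before; auto; lra.
Qed.

Lemma prolong_derive_after x T w t l :
  T < t -> is_derive w (t - T) l -> is_derive (prolong x T w) t l.
Proof.
  intros Ht Hw. apply is_derive_ext_loc with (fun s => x T + w (s - T)).
  - apply filter_imp with (2 := locally_interval T (t + 1) t ltac:(lra)).
    intros; rewrite prolong_after; auto; lra.
  - replace l with (0 + 1 * l) by ring.
    apply (is_derive_plus (fun _ => x T)).
    + apply (is_derive_const (x T)).
    + apply (is_derive_comp w (fun s => s - T)); auto. auto_derive; auto; ring.
Qed.

Lemma continuous_before (u v : R -> R) T t :
  t < T -> (forall s, s < T -> u s = v s) -> continuous u t -> continuous v t.
Proof.
  intros Ht E. apply continuous_ext_loc.
  apply filter_imp with (2 := locally_interval (t - 1) T t ltac:(lra)).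
  intros; apply E; lra.
Qed.

Lemma motion_move f T p q a c :
  C1_field f -> 0 <= T -> motion f T p q -> motion f (T + 1) p (move f q a c).
Proof.
  intros Hf HT (u1 & u2 & x1 & x2 & x3 & S1 & S2 & C1 & C2 & C3 & D & E0 & ET).
  assert (L0 : lift f (x1 T) (x2 T) a c 0 = 0)
    by exact (RInt_point (V := R_CompleteNormedModule) 0 _).
  exists (switch u1 T a), (switch u2 T c), (prolong x1 T (fun s => a * s)),
    (prolong x2 T (fun s => c * s)), (prolong x3 T (lift f (x1 T) (x2 T) a c)).
  split; [|split; [|split; [|split; [|split; [|split; [|split]]]]]].
  - now apply switch_subdivision.
  - now apply switch_subdivision.
  - intros; apply prolong_continuous; auto; intros.
    apply (ex_derive_continuous (fun s => a * s)); auto_derive; auto.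
  - intros; apply prolong_continuous; auto; intros.
    apply (ex_derive_continuous (fun s => c * s)); auto_derive; auto.
  - intros; apply prolong_continuous; auto; intros.
    apply (ex_derive_continuous (lift f (x1 T) (x2 T) a c)).
    eexists; apply lift_derive; auto.
  - intros t Ht K1 K2. destruct (Rtotal_order t T) as [H|[->|H]].
    + destruct (D t) as (D1 & D2 & D3); [lra| | |].
      * apply continuous_before with (3 := K1) (T := T); auto.
        intros; apply switch_before; auto.
      * apply continuous_before with (3 := K2) (T := T); auto.
        intros; apply switch_before; auto.
      * rewrite !switch_before, !prolong_before by lra.
        split; [|split]; (apply prolong_derive_before; [auto; ring|auto|auto]).
    + exfalso; eapply switch_not_continuous, K1.
    + rewrite !switch_after, (prolong_after x1), (prolong_after x2) by lra.
      split; [|split]; (apply prolong_derive_after; [auto|]).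
      * auto_derive; auto; ring.
      * auto_derive; auto; ring.
      * apply lift_derive; auto.
  - rewrite !prolong_before by (auto; ring). auto.
  - rewrite !prolong_after by lra. replace (T + 1 - T) with 1 by ring.
    rewrite <- ET; unfold move. repeat f_equal; ring.
Qed.

Lemma polygonal_motion f p q :
  C1_field f -> polygonal f p q -> exists T, 0 <= T /\ motion f T p q.
Proof.
  intros Hf; induction 1 as [|q a c _ (T & HT & M)].
  - exists 0; split; [lra|]. destruct p as [[x y] z].
    exists (fun _ => 0), (fun _ => 0), (fun _ => x), (fun _ => y), (fun _ => z).
    repeat split; try (intros; apply continuous_const); try constructor; lra.
  - exists (T + 1); split; [lra|]. apply motion_move; auto.
Qed.

Lemma piecewise_continuous_of_subdivision u a b :
  subdivision (continuous_piece u) a b -> piecewise_continuous u a b.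
Proof. intros S; exact (partition_of_subdivision _ _ _ S). Qed.

Lemma curl_controllable f :
  C1_field f -> ~ (forall p, curl f p = 0) -> controllable f.
Proof.
  intros Hf Hc p q.
  assert (HC : exists a x b y, circulation f a x b y <> 0).
  { apply NNPP; intros H; apply Hc, circulation_free_curl; auto.
    intros a x b y; apply NNPP; intros H'; apply H; eauto. }
  destruct HC as (a & x & b & y & HC).
  destruct (polygonal_full f a x b y p q Hf HC) as (r & c & d & Hr & <-).
  destruct (polygonal_motion f p r Hf Hr) as (T & HT & M).
  apply (motion_move f T p r c d Hf HT) in M.
  destruct M as (u1 & u2 & x1 & x2 & x3 & S1 & S2 & C1 & C2 & C3 & D & E0 & ET).
  exists (T + 1), u1, u2, x1, x2, x3.
  repeat split; auto using piecewise_continuous_of_subdivision; try lra;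
    try (apply continuous_on_forall; auto); try (apply D; auto).
Qed.

(** The inputs and the derivatives of the state agree only where both inputs are
    continuous, so the pieces are those of a common refinement of the two
    partitions. *)
Lemma controllable_loop f :
  C1_field f -> controllable f ->
  exists a b g, closed_loop g a b /\ line_integral f g a b <> 0.
Proof.
  intros Hf Hc.
  destruct (Hc (0, 0, 0) (0, 0, 1)) as
    (T & u1 & u2 & x1 & x2 & x3 & HT & (n & t & Pn & Sn) & (m & s & Pm & Sm) &
     (C1 & C2 & C3 & D) & E0 & ET).
  injection E0 as E01 E02 E03; injection ET as ET1 ET2 ET3.
  assert (S : subdivision (fun c d => (C1_piece x1 c d /\ C1_piece x2 c d) /\
     forall t, c < t < d -> is_derive x3 t (integrand f x1 x2 t)) 0 T).
  { generalize (subdivision_refine _ _ 0 T (continuous_piece_hereditary u1)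
      (continuous_piece_hereditary u2)
      (subdivision_of_partition _ _ _ _ _ Pn Sn)
      (subdivision_of_partition _ _ _ _ _ Pm Sm)).
    apply subdivision_impl; intros c d Hc0 Hcd HdT [K1 K2].
    assert (D' : forall r, c < r < d -> is_derive x1 r (u1 r) /\
      is_derive x2 r (u2 r) /\ is_derive x3 r
        (comp1 f (x1 r, x2 r) * u1 r + comp2 f (x1 r, x2 r) * u2 r)).
    { intros r Hr; apply D; [lra|apply K1; auto|apply K2; auto]. }
    split; [split; split|].
    - intros r Hr; eexists; apply D'; auto.
    - apply continuous_piece_ext with u1; auto.
      intros r Hr; symmetry; apply is_derive_unique, D'; auto.
    - intros r Hr; eexists; apply D'; auto.
    - apply continuous_piece_ext with u2; auto.
      intros r Hr; symmetry; apply is_derive_unique, D'; auto.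
    - intros r Hr; destruct (D' r Hr) as (D1 & D2 & D3).
      unfold integrand.
      rewrite (is_derive_unique _ _ _ D1), (is_derive_unique _ _ _ D2); auto. }
  assert (P : forall x, continuous_on (segment 0 T) x ->
     subdivision (C1_piece x) 0 T -> piecewise_C1 x 0 T).
  { intros x Hx Sx; split; auto. exact (partition_of_subdivision _ _ _ Sx). }
  exists 0, T, (fun t => (x1 t, x2 t)); split.
  - repeat split; auto.
    + apply P; auto. revert S; apply subdivision_impl; tauto.
    + apply P; auto. revert S; apply subdivision_impl; tauto.
    + now rewrite E01, E02, ET1, ET2.
  - pose proof (line_integral_primitive f x1 x2 x3 0 T Hf S C1 C2 C3) as I.
    change (RInt (integrand f x1 x2) 0 T <> 0).
    rewrite (is_RInt_unique _ _ _ _ I). lra.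
Qed.

Theorem mainTheorem2 (f : R * R -> R * R) (Hf : C1_field f) :
  (controllable f <->
   exists (a b : R) (gamma : R -> R * R),
     closed_loop gamma a b /\ line_integral f gamma a b <> 0) /\
  ((exists (a b : R) (gamma : R -> R * R),
     closed_loop gamma a b /\ line_integral f gamma a b <> 0) <->
   ~ (forall x : R * R, curl f x = 0)).
Proof.
  assert (loop_curl : (exists (a b : R) (gamma : R -> R * R),
     closed_loop gamma a b /\ line_integral f gamma a b <> 0) ->
     ~ (forall x : R * R, curl f x = 0)).
  { intros (a & b & g & Hg & HI) Hc. apply HI, curl_free_closed_loop; auto. }
  pose proof (controllable_loop f Hf) as H1.
  pose proof (curl_controllable f Hf) as H2.
  tauto.
Qed.
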